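(* Let $n\ge2$, let $X_1,\dots,X_n$ be Banach spaces and $D_k\in\mathcal{B}(X_k)$, and assume that $D_s-\lambda$ satisfies the complements condition for all $2\le s\le n-1$ and all $\lambda\in\mathbb{C}$. Then for every $A\in\mathcal{B}_n$, $$\bigcup_{k=1}^n\sigma_{re}(D_k)=\sigma_{re}(T_n^d(A))\cup\Delta_1\cup\Delta_2,$$ where $$\Delta_1=\bigcup_{k=1}^{n-1}\Big\{\lambda:\ \beta(D_k-\lambda)=\infty,\ \beta(D_s-\lambda)<\infty\text{ for }k+1\le s\le n-1,\ \sum_{s=k+1}^{n}\alpha(D_s-\lambda)=\infty\Big\}\cap\rho_{re}(D_n)$$ (for $k=n-1$ the condition on $k+1\le s\le n-1$ is vacuous), and $$\Delta_2=\bigcup_{k=1}^{n}\Big\{\lambda:\ \beta(D_s-\lambda)<\infty\text{ for all }1\le s\le n,\ \text{and }\mathcal{N}(D_k-\lambda)\text{ is not complemented}\Big\}.$$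
   Context: For a bounded operator $T$ between Banach spaces, $\alpha(T)=\dim\mathcal{N}(T)$, $\beta(T)=\operatorname{codim}\mathcal{R}(T)$, values in $\{0,1,\dots\}\cup\{\infty\}$, sums taken in this extended set. $T\in\mathcal{B}(X,Y)$ satisfies the complements condition if $\mathcal{N}(T)$ is topologically complemented in $X$ and $\overline{\mathcal{R}(T)}$ is topologically complemented in $Y$. $T$ is right Fredholm if $\beta(T)<\infty$ and $\mathcal{N}(T)$ is complemented; $\sigma_{re}(T)=\{\lambda\in\mathbb{C}:\lambda-T$ not right Fredholm$\}$, $\rho_{re}=\mathbb{C}\setminus\sigma_{re}$. $\mathcal{B}_n$ is the set of tuples $A=(A_{ij})_{1\le i<j\le n}$, $A_{ij}\in\mathcal{B}(X_j,X_i)$; $T_n^d(A)$ is the upper triangular operator matrix on $X_1\oplus\cdots\oplus X_n$ with diagonal $D_1,\dots,D_n$, entries $A_{ij}$ above the diagonal and zeros below. *)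

(* Defs.v *)
From HB Require Import structures.
From mathcomp Require Import all_boot all_order all_algebra.
From mathcomp Require Import all_classical all_reals all_analysis.
From mathcomp.real_closed Require Export complex.
Export numFieldNormedType.Exports.

Set Implicit Arguments.
Unset Strict Implicit.
Unset Printing Implicit Defensive.

Import Order.TTheory GRing.Theory Num.Theory.
Local Open Scope classical_set_scope.
Local Open Scope ring_scope.

Definition enat := option nat.
Definition einf : enat := None.
Definition eadd (a b : enat) : enat :=
  match a, b with Some x, Some y => Some (x + y)%N | _, _ => None end.

Lemma least_nat_ex (P : nat -> Prop) :
  (exists n, P n) -> exists n, `[< P n >].
Proof. by case=> n Pn; exists n; apply/asboolP. Qed.

Definition least_nat (P : nat -> Prop) : enat :=
  match pselect (exists n, P n) with
  | left h => Some (ex_minn (least_nat_ex h))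
  | right _ => None
  end.

Section Operators.
Variable K : numDomainType.

Definition is_linear (V W : lmodType K) (T : V -> W) :=
  forall (a : K) (x y : V), T (a *: x + y) = a *: T x + T y.

Definition bounded_op (V W : preTopologicalLmodType K) (T : V -> W) :=
  is_linear T /\ continuous T.

Variables V W : preTopologicalLmodType K.

Definition kerS (T : V -> W) : set V := [set x | T x = 0].

Definition spanned_by (S : set V) (n : nat) :=
  exists v : 'I_n -> V, (forall i, S (v i)) /\
    forall x, S x -> exists c : 'I_n -> K, x = \sum_(i < n) c i *: v i.

Definition cospanned_by (S : set W) (m : nat) :=
  exists w : 'I_m -> W, forall y : W,
    exists (s : W) (c : 'I_m -> K), S s /\ y = s + \sum_(i < m) c i *: w i.

(* alpha T = dim N(T), beta T = codim R(T) *)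
Definition alpha (T : V -> W) : enat := least_nat (spanned_by (kerS T)).
Definition beta (T : V -> W) : enat := least_nat (cospanned_by (range T)).

End Operators.

Section Complemented.
Variable K : numDomainType.
Variable V : preTopologicalLmodType K.

Definition complemented (M : set V) :=
  exists P : V -> V, bounded_op P /\ (forall x, P (P x) = P x) /\ range P = M.
End Complemented.

Section Fredholm.
Variable K : numDomainType.
Variables V W : preTopologicalLmodType K.

Definition complements_condition (T : V -> W) :=
  complemented (kerS T) /\ complemented (closure (range T)).

Definition right_fredholm (T : V -> W) :=
  beta T <> einf /\ complemented (kerS T).
End Fredholm.

Section Spectrum.
Variable K : numDomainType.
Variable V : preTopologicalLmodType K.

Definition lmT (lambda : K) (T : V -> V) : V -> V := fun x => lambda *: x - T x.
Definition Tml (T : V -> V) (lambda : K) : V -> V := fun x => T x - lambda *: x.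

Definition sigma_re (T : V -> V) : set K :=
  [set lambda | ~ right_fredholm (lmT lambda T)].
Definition rho_re (T : V -> V) : set K := ~` sigma_re T.
End Spectrum.

Section DirectSum.
Variable R : realType.
Variable n : nat.
Variable X : 'I_n -> completeNormedModType R[i].

Definition dsum := forall i : 'I_n, X i.

Definition dsum_zero : dsum := fun i => 0.
Definition dsum_add (x y : dsum) : dsum := fun i => x i + y i.
Definition dsum_opp (x : dsum) : dsum := fun i => - x i.
Definition dsum_scale (a : R[i]) (x : dsum) : dsum := fun i => a *: x i.

Lemma dsum_addA : associative dsum_add.
Proof. by move=> x y z; apply: functional_extensionality_dep => i; rewrite /dsum_add addrA. Qed.
Lemma dsum_addC : commutative dsum_add.
Proof. by move=> x y; apply: functional_extensionality_dep => i; rewrite /dsum_add addrC. Qed.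
Lemma dsum_add0 : left_id dsum_zero dsum_add.
Proof. by move=> x; apply: functional_extensionality_dep => i; rewrite /dsum_add add0r. Qed.
Lemma dsum_addN : left_inverse dsum_zero dsum_opp dsum_add.
Proof. by move=> x; apply: functional_extensionality_dep => i; rewrite /dsum_add /dsum_opp addNr. Qed.

HB.instance Definition _ := Choice.copy dsum (forall i : 'I_n, (X i : topologicalType)).
HB.instance Definition _ := GRing.isZmodule.Build dsum dsum_addA dsum_addC dsum_add0 dsum_addN.

Lemma dsum_scaleA a b (x : dsum) : dsum_scale a (dsum_scale b x) = dsum_scale (a * b) x.
Proof. by apply: functional_extensionality_dep => i; rewrite /dsum_scale scalerA. Qed.
Lemma dsum_scale1 (x : dsum) : dsum_scale 1 x = x.
Proof. by apply: functional_extensionality_dep => i; rewrite /dsum_scale scale1r. Qed.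
Lemma dsum_scaleDr a : {morph dsum_scale a : x y / (x + y : dsum)}.
Proof. by move=> x y; apply: functional_extensionality_dep => i; rewrite /dsum_scale scalerDr. Qed.
Lemma dsum_scaleDl (x : dsum) : {morph dsum_scale^~ x : a b / a + b}.
Proof. by move=> a b; apply: functional_extensionality_dep => i; rewrite /dsum_scale scalerDl. Qed.

HB.instance Definition _ := GRing.Zmodule_isLmodule.Build R[i] dsum
  dsum_scaleA dsum_scale1 dsum_scaleDr dsum_scaleDl.
(* product topology (= norm topology, the product being finite) *)
HB.instance Definition _ := Topological.copy dsum (prod_topology (fun i : 'I_n => (X i : topologicalType))).

Definition Tnd (D : forall k : 'I_n, X k -> X k)
  (A : forall i j : 'I_n, X j -> X i) : dsum -> dsum :=
  fun x i => D i (x i) + \sum_(j < n | (i < j)%N) A i j (x j).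

Variable D : forall k : 'I_n, X k -> X k.

Definition Delta1 : set R[i] :=
  \bigcup_(k in [set k : 'I_n | (k < n.-1)%N])
    ([set lambda | beta (Tml (@D k) lambda) = einf
       /\ (forall s : 'I_n, (k < s)%N -> (s < n.-1)%N ->
             beta (Tml (@D s) lambda) <> einf)
       /\ \big[eadd/Some 0%N]_(s < n | (k < s)%N) alpha (Tml (@D s) lambda) = einf]
     `&` [set lambda | forall s : 'I_n, val s = n.-1 -> rho_re (@D s) lambda]).

Definition Delta2 : set R[i] :=
  \bigcup_(k in [set: 'I_n])
    [set lambda | (forall s : 'I_n, beta (Tml (@D s) lambda) <> einf)
       /\ ~ complemented (kerS (Tml (@D k) lambda))].

End DirectSum.

(* Main.v *)
Require Import Defs.
From HB Require Import structures.
From mathcomp Require Import all_boot all_order all_algebra.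
From mathcomp Require Import all_classical all_reals all_analysis.
From mathcomp.real_closed Require Import complex.
From mathcomp Require Import ring lra.
Import Order.TTheory GRing.Theory Num.Theory.
Import numFieldNormedType.Exports.

(** Everything rests on Atkinson's description: [T] is right Fredholm iff
    [T S = 1 - F] for some bounded [S] and some bounded finite-rank [F]; the
    nontrivial half is the open mapping theorem.  If all diagonal entries have such
    regularizers, back-substitution yields one for the triangular operator.
    Conversely, the (n, n) corner of a regularizer of the triangular operator [T]
    regularizes [D_n].  If [T] is right Fredholm, no [lambda] of the left-hand side
    outside [Delta2] can have all [beta (D_s - lambda)] finite; let [k] be the last
    index with an infinite one.  Then some [alpha (D_s - lambda)] with [s > k] is
    infinite: otherwise restricting [T] to vectors supported on the first [t]
    coordinates, and decreasing [t] from [n] to [k], would preserve finite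
    codimension of the range at each step, and [D_k - lambda] would have a range of
    finite codimension.

    The norms below are real valued, whereas those of normed modules over [R[i]]
    take values in [R[i]]; they make the open mapping theorem available on [dsum],
    which carries a topology but no norm. *)

Set Implicit Arguments.
Unset Strict Implicit.
Unset Printing Implicit Defensive.
Local Open Scope classical_set_scope.
Local Open Scope ring_scope.
Local Open Scope complex_scope.

(** * Real-valued complete norms and bounded linear maps *)

Section BoundedLinear.
Variable R : realType.
Local Notation K := R[i].

Definition cmod (a : K) : R := complex.Re `|a|.

Lemma normcE_cmod (a : K) : `|a| = (cmod a)%:C.
Proof. by rewrite /cmod normc_def. Qed.

Lemma cmodM (a b : K) : cmod (a * b) = cmod a * cmod b.
Proof. by apply: complexI; rewrite rmorphM /= -!normcE_cmod normrM. Qed.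

Lemma cmod_ge0 (a : K) : 0 <= cmod a.
Proof. by rewrite -lecR -normcE_cmod normr_ge0. Qed.

Lemma cmodD (a b : K) : cmod (a + b) <= cmod a + cmod b.
Proof. by rewrite -lecR rmorphD /= -!normcE_cmod ler_normD. Qed.

Lemma cmod_real (t : R) : 0 <= t -> cmod t%:C = t.
Proof. by move=> t0; apply: complexI; rewrite -normcE_cmod ger0_norm// ler0c. Qed.

Lemma cmodN1 : cmod (-1) = 1.
Proof. by apply: complexI; rewrite -normcE_cmod normrN1. Qed.

Lemma cmod0 : cmod 0 = 0.
Proof. by rewrite /cmod normr0. Qed.

Lemma cmod_eq0 (a : K) : cmod a = 0 -> a = 0.
Proof. by move=> a0; apply/eqP; rewrite -normr_eq0 normcE_cmod a0. Qed.

Section SeqDef.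
Variables (V : lmodType K) (p : V -> R).
Definition norm_cauchy (u : nat -> V) := forall e : R, 0 < e ->
  exists N, forall n m, (N <= n)%N -> (N <= m)%N -> p (u m - u n) < e.
Definition norm_cvg (u : nat -> V) (x : V) := forall e : R, 0 < e ->
  exists N, forall n, (N <= n)%N -> p (x - u n) < e.
End SeqDef.

(** A predicate on a function rather than a structure on the module, so that one notion serves
    normed modules, the scalars, products and [dsum]. Nonnegativity and [p 0 = 0] follow from the
    first two fields. *)
Record banach_norm (V : lmodType K) (p : V -> R) : Prop := BanachNorm {
  bnormD : forall x y, p (x + y) <= p x + p y;
  bnormZ : forall a x, p (a *: x) = cmod a * p x;
  bnorm_eq0 : forall x, p x = 0 -> x = 0;
  bnorm_complete : forall u, norm_cauchy p u -> exists x, norm_cvg p u x }.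

Section NormTheory.
Variables (V : lmodType K) (p : V -> R).
Hypothesis hp : banach_norm p.

Lemma bnorm0 : p 0 = 0.
Proof. by rewrite -(scale0r 0) (bnormZ hp) cmod0 mul0r. Qed.

Lemma bnormN x : p (- x) = p x.
Proof. by rewrite -scaleN1r (bnormZ hp) cmodN1 mul1r. Qed.

Lemma bnormC x y : p (x - y) = p (y - x).
Proof. by rewrite -bnormN opprB. Qed.

Lemma bnormB x y : p (x - y) <= p x + p y.
Proof. by rewrite -(bnormN y) (bnormD hp). Qed.

Lemma bnorm_ge0 x : 0 <= p x.
Proof. by have := bnormB x x; rewrite subrr bnorm0 -mulr2n -mulr_natl pmulr_rge0. Qed.

Lemma bnorm_tri y x z : p (x - z) <= p (x - y) + p (y - z).
Proof. by rewrite -[x - z](subrKA y) (bnormD hp). Qed.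

(** An explicit Cauchy rate passes to the limit. Both iterative constructions of the open mapping
    theorem end with this step. *)
Lemma bnorm_cvg_rate (u : nat -> V) (r : nat -> R) :
  (forall e, 0 < e -> exists N, r N < e) ->
  (forall n m, (n <= m)%N -> p (u m - u n) <= r n) ->
  exists x, forall n, p (x - u n) <= r n.
Proof.
move=> r0 ur; have [|x ux] := bnorm_complete hp (u := u).
  move=> e e0; have [|N rN] := r0 (e / 2); first by lra.
  exists N => n m Nn Nm; have := bnorm_tri (u N) (u m) (u n).
  have := ur _ _ Nn; have := ur _ _ Nm; rewrite (bnormC (u N)); lra.
exists x => n; apply/ler_addgt0Pr => e /ux[N uN].
have := uN _ (leq_maxl N n); have := ur _ _ (leq_maxr N n).
have := bnorm_tri (u (maxn N n)) x (u n); lra.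
Qed.
End NormTheory.

Definition blin (V W : lmodType K) (p : V -> R) (q : W -> R) (f : V -> W) :=
  is_linear f /\ exists2 C : R, 0 <= C & forall x, q (f x) <= C * p x.

Section IsLinear.
Variables (V W : lmodType K) (f : V -> W).
Hypothesis lf : is_linear f.

Lemma is_linearD x y : f (x + y) = f x + f y.
Proof. by have := lf 1 x y; rewrite !scale1r. Qed.
Lemma is_linear0 : f 0 = 0.
Proof. by apply: (addrI (f 0)); rewrite -is_linearD !addr0. Qed.
Lemma is_linearZ a x : f (a *: x) = a *: f x.
Proof. by have := lf a x 0; rewrite is_linear0 !addr0. Qed.
Lemma is_linearN x : f (- x) = - f x.
Proof. by rewrite -scaleN1r is_linearZ scaleN1r. Qed.
Lemma is_linearB x y : f (x - y) = f x - f y.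
Proof. by rewrite is_linearD is_linearN. Qed.
Lemma is_linear_sum (I : Type) (s : seq I) (P : pred I) (F : I -> V) :
  f (\sum_(i <- s | P i) F i) = \sum_(i <- s | P i) f (F i).
Proof. exact: (big_morph f is_linearD is_linear0). Qed.
End IsLinear.

End BoundedLinear.

(** * Complete norms on the scalars and on normed modules *)

Section Complete.
Variable R : realType.
Local Notation K := R[i].

Lemma cauchy_seq_cvg (F : numFieldType) (V : completeNormedModType F) (u : nat -> V) :
  (forall e : F, 0 < e -> exists N, forall n m, (N <= n)%N -> (N <= m)%N -> `|u m - u n| < e) ->
  exists x, forall e : F, 0 < e -> exists N, forall n, (N <= n)%N -> `|x - u n| < e.
Proof.
move=> cu; have : cvg (u @ \oo).
  apply/cauchy_cvgP/cauchy_exP => e /cu[N uN].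
  exists (u N); exists N => // n /= Nn; rewrite -ball_normE /=.
  by rewrite distrC; apply: uN.
move=> /cvg_ex[x ux]; exists x => e e0.
by move/cvgrPdist_lt: ux => /(_ e e0)[N _ uN]; exists N => n /uN.
Qed.

Lemma cmod_Re (a : K) : `|complex.Re a| <= cmod a.
Proof. by rewrite -lecR -normcE_cmod normc_ge_Re. Qed.

Lemma cmod_i : cmod ('i : K) = 1.
Proof. by rewrite /cmod normc_def /= expr0n expr1n add0r sqrtr1. Qed.

Lemma cmod_Im (a : K) : `|complex.Im a| <= cmod a.
Proof.
rewrite -normrN -ReiNIm (le_trans (cmod_Re _))// cmodM cmod_i mulr1//.
Qed.

Lemma cmod_le_ReIm (a : K) : cmod a <= `|complex.Re a| + `|complex.Im a|.
Proof.
have cR (t : R) : cmod t%:C = `|t|.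
  by rewrite /cmod normc_def /= expr0n addr0 sqrtr_sqr.
rewrite {1}[a]complexE (le_trans (cmodD _ _))// cmodM cmod_i mul1r.
by rewrite !cR.
Qed.

Lemma cmod_banach : banach_norm (@cmod R : K^o -> R).
Proof.
split; [exact: cmodD|exact: cmodM|exact: cmod_eq0|].
move=> u cu.
have [|x ux] := @cauchy_seq_cvg R R (fun n => complex.Re (u n)).
  move=> e /cu[N uN]; exists N => n m Nn Nm.
  by rewrite (le_lt_trans _ (uN _ _ Nn Nm))// -raddfB cmod_Re.
have [|y uy] := @cauchy_seq_cvg R R (fun n => complex.Im (u n)).
  move=> e /cu[N uN]; exists N => n m Nn Nm.
  by rewrite (le_lt_trans _ (uN _ _ Nn Nm))// -raddfB cmod_Im.
exists (x +i* y) => e e0; have e20 : 0 < e / 2 by lra.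
have [N uN] := ux _ e20; have [M uM] := uy _ e20.
exists (maxn N M) => n; rewrite geq_max => /andP[/uN + /uM].
have := cmod_le_ReIm (x +i* y - u n).
by case: (u n) => a b /=; lra.
Qed.

Definition rnorm (V : normedModType K) (x : V) : R := complex.Re `|x|.

Lemma normrE_rnorm (V : normedModType K) (x : V) : `|x| = (rnorm x)%:C.
Proof. by rewrite /rnorm RRe_real// ger0_real. Qed.

Lemma rnorm_banach (V : completeNormedModType K) : banach_norm (@rnorm V).
Proof.
split=> [x y|a x|x x0|u cu].
- by rewrite -lecR rmorphD /= -!normrE_rnorm ler_normD.
- by apply: complexI; rewrite rmorphM /= -normcE_cmod -!normrE_rnorm normrZ.
- by apply/eqP; rewrite -normr_eq0 normrE_rnorm x0.
have [|x ux] := @cauchy_seq_cvg _ V u.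
  move=> e e0; have eE : e = (complex.Re e)%:C by rewrite RRe_real// gtr0_real.
  move: e0; rewrite eE ltcR => /cu[N uN]; exists N => n m Nn Nm.
  by rewrite normrE_rnorm ltcR uN.
exists x => e; rewrite -ltcR => /ux[N uN]; exists N => n /uN.
by rewrite normrE_rnorm ltcR.
Qed.

Lemma bounded_op_blin (V W : normedModType K) (f : V -> W) :
  bounded_op f <-> blin (@rnorm V) (@rnorm W) f.
Proof.
split=> [[lf cf]|[lf [C C0 fC]]]; split=> //.
  pose F : {linear V -> W} := HB.pack f (GRing.isLinear.Build K V W *:%R f lf).
  have /linear_boundedP : bounded_near F (nbhs 0) by apply/linear_bounded_continuous.
  move=> /pinfty_ex_gt0[M M0 FM]; exists (complex.Re M).
    by have := M0; rewrite ltcE /= => /andP[_ /ltW].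
  move=> x; have := FM x; rewrite !normrE_rnorm /=.
  have {1}-> : M = (complex.Re M)%:C by rewrite RRe_real// gtr0_real.
  by rewrite -rmorphM lecR.
pose F : {linear V -> W} := HB.pack f (GRing.isLinear.Build K V W *:%R f lf).
apply/(@linear_bounded_continuous _ _ _ F)/linear_boundedP.
near=> r => x; rewrite /= !normrE_rnorm.
have Cr : C%:C <= r by near: r; apply: nbhs_pinfty_ge; rewrite ger0_real// ler0c.
apply: (@le_trans _ _ (C%:C * (rnorm x)%:C)); first by rewrite -rmorphM lecR.
by rewrite ler_wpM2r// -normrE_rnorm.
Unshelve. all: by end_near. Qed.

End Complete.

(** * The open mapping theorem *)

Section OpenMapping.
Variable R : realType.
Local Notation K := R[i].

Lemma half_pow_small (c e : R) : 0 < e -> exists N, c * 2^-1 ^+ N < e.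
Proof.
move=> e0; exists (Num.bound `|c / e|); set N := Num.bound _.
rewrite exprVn ltr_pdivrMr ?exprn_gt0// -ltr_pdivrMl// mulrC.
rewrite (le_lt_trans (ler_norm _))// (lt_le_trans (archi_boundP _))//.
by rewrite -natrX ler_nat ltnW// ltn_expl.
Qed.

(** Baire's theorem in metric form. If no [A n] were dense in a ball, one could choose nested balls
    with radii at least halved each time, the ball of index n+1 avoiding [A n]; the limit of the
    centres would lie in no [A n]. *)
Lemma baire_ball (W : lmodType K) (q : W -> R) (A : nat -> set W) :
  banach_norm q -> (forall y, exists n, A n y) ->
  exists n y0 r, 0 < r /\ forall y, q (y - y0) < r ->
    forall e, 0 < e -> exists2 z, A n z & q (y - z) < e.
Proof.
move=> hq cover; apply: contrapT => nball.
have step (n : nat) (yr : W * R) : exists yr' : W * R, 0 < yr.2 ->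
    [/\ q (yr'.1 - yr.1) <= yr.2 / 2, 0 < yr'.2, yr'.2 <= yr.2 / 2 &
        forall z, A n z -> yr'.2 < q (z - yr'.1)].
  (* The choice function must be total, so a nonpositive radius gets a dummy answer; the radii of
     the actual sequence stay positive by [s0]. *)
  case: yr => y0 r /=; have [r0|] := ltP 0 r; last by exists (0, 0).
  apply: contrapT => nex; apply: nball; exists n, y0, (r / 2).
  split=> [|y yy0 e e0]; first by lra.
  apply: contrapT => nz; apply: nex.
  exists (y, Num.min (r / 2) (e / 2)) => /= _.
  split; [exact: ltW | by rewrite lt_min; apply/andP; split; lra
         | by rewrite ge_min lexx |].
  move=> z Az; rewrite gt_min; apply/orP; right.
  suff : e <= q (y - z) by rewrite (bnormC hq); lra.
  by rewrite leNgt; apply/negP => qe; apply: nz; exists z.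
have [g gP] := choice (fun nyr => step nyr.1 nyr.2).
pose s := fix s n := if n is m.+1 then g (m, s m) else (0, 1).
have s0 n : 0 < (s n).2 by elim: n => //= n IH; case: (gP (n, s n) IH).
have sP n := gP (n, s n) (s0 n).
have s2 n : (s n).2 <= 2^-1 ^+ n.
  elim: n => [|n IH]; first by rewrite expr0.
  by rewrite exprS; case: (sP n) => _ _ /= + _; lra.
(* Nestedness: the centres move by at most the radius lost. *)
have sC n k : q ((s (k + n)%N).1 - (s n).1) <= (s n).2 - (s (k + n)%N).2.
  elim: k => [|k IH]; first by rewrite add0n !subrr (bnorm0 hq).
  have := bnorm_tri hq (s (k + n)%N).1 (s (k.+1 + n)%N).1 (s n).1.
  by case: (sP (k + n)%N) => /=; lra.
have [||x xP] := bnorm_cvg_rate hq (u := fun n => (s n).1) (r := fun n => (s n).2).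
- move=> e /(half_pow_small 1)[N]; rewrite mul1r => Ne; exists N.
  exact: le_lt_trans (s2 N) Ne.
- move=> n m /subnK <-; apply: (le_trans (sC _ _)).
  by rewrite gerBl ltW.
have [n An] := cover x.
by case: (sP n) => _ _ _ /(_ _ An); rewrite ltNge (xP n.+1).
Qed.

Section Onto.
Variables (V W : lmodType K) (p : V -> R) (q : W -> R) (T : V -> W).
Hypotheses (hp : banach_norm p) (hq : banach_norm q) (bT : blin p q T).
Hypothesis onto : forall y, exists x, T x = y.
Let lT := bT.1.

(** The images of the balls of integer radius cover [W], so one of them is dense in some ball.
    Differences of two approximations recentre that ball at the origin, and scaling reaches every
    [y]. *)
Lemma almost_open : exists2 C, 0 <= C & forall y e, 0 < e ->
  exists2 x, p x <= C * q y & q (y - T x) < e.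
Proof.
have [|n [y0 [r [r0 rP]]]] := @baire_ball W q (fun n => T @` [set x | p x <= n%:R]) hq.
  move=> y; have [x <-] := onto y; exists (Num.bound (p x)), x => //=.
  by apply/ltW/archi_boundP/(bnorm_ge0 hp).
have ball0 y e : 0 < e -> q y < r -> exists2 x, p x <= n%:R *+ 2 & q (y - T x) < e.
  move=> e0 yr; have e20 : 0 < e / 2 by lra.
  have [|_ [x1 /= px1 <-] qx1] := rP (y + y0) _ _ e20; first by rewrite addrK.
  have [|_ [x2 /= px2 <-] qx2] := rP y0 _ _ e20; first by rewrite subrr (bnorm0 hq).
  exists (x1 - x2); first by have := bnormB hp x1 x2; lra.
  rewrite (is_linearB lT) opprB addrA.
  have := bnormB hq (y + y0 - T x1) (y0 - T x2).
  rewrite (_ : y + y0 - T x1 - (y0 - T x2) = y + T x2 - T x1); last first.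
    by rewrite opprB [T x2 - y0]addrC addrA [y + y0 - _]addrAC addrK addrAC.
  lra.
(* Scaling [y] by [t = r / (2 q y)] puts it in the ball, where preimages have norm at most [2 n];
   dividing by [t] gives [(4 n / r) q y]. *)
exists (4 * n%:R / r); first by rewrite divr_ge0 ?mulr_ge0// ltW.
move=> y e e0; have [qy0|qy0] := eqVneq (q y) 0.
  exists 0; first by rewrite (bnorm0 hp) qy0 mulr0.
  by rewrite (is_linear0 lT) subr0 qy0.
have {}qy0 : 0 < q y by rewrite lt_def qy0 (bnorm_ge0 hq).
pose t := r / (2 * q y); have t0 : 0 < t by rewrite divr_gt0// mulr_gt0.
have tK : t%:C != 0 by rewrite gt_eqF// ltcR.
have ct : cmod t%:C = t by rewrite cmod_real// ltW.
have cV : cmod t%:C^-1 = t^-1.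
  apply: (mulfI (lt0r_neq0 t0)); rewrite -{1}ct -cmodM (divff tK) divff ?lt0r_neq0//.
  by rewrite cmod_real.
have [||x px qx] := ball0 (t%:C *: y) (t * e); first by rewrite mulr_gt0.
  rewrite (bnormZ hq) ct (_ : t * q y = r / 2); first by lra.
  by rewrite /t; field; rewrite lt0r_neq0.
exists (t%:C^-1 *: x).
  rewrite (bnormZ hp) cV ler_pdivrMl// (le_trans px)//.
  rewrite /t -mulr_natl le_eqVlt; apply/orP; left; apply/eqP.
  field; by rewrite !lt0r_neq0.
rewrite -(ltr_pM2l t0) (is_linearZ lT).
by rewrite -{1}ct -(bnormZ hq) scalerBr scalerA divff ?scale1r.
Qed.

(** Successive correction: the residual of each partial sum is approximately lifted in turn, with
    the error bound halved. The corrections are dominated by a geometric series, whence the factor 2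
    in the constant. *)
Theorem bounded_lifting : exists2 C, 0 <= C & forall y, exists2 x, T x = y & p x <= C * q y.
Proof.
have [C C0 CP] := almost_open.
exists (C * 2); first by rewrite mulr_ge0.
move=> y; have [y0|y0] := eqVneq (q y) 0.
  have -> : y = 0 by exact: bnorm_eq0 y0.
  by exists 0; rewrite ?(is_linear0 lT)// (bnorm0 hp) (bnorm0 hq) mulr0.
have {}y0 : 0 < q y by rewrite lt_def y0 (bnorm_ge0 hq).
have /choice[g gP] (zk : W * nat) : exists x, p x <= C * q zk.1 /\
    q (zk.1 - T x) < q y * 2^-1 ^+ zk.2.+1.
  case: zk => z k /=.
  have [|x] := CP z (q y * 2^-1 ^+ k.+1); last by exists x.
  by rewrite mulr_gt0// exprn_gt0// invr_gt0.
pose s := fix s n := if n is m.+1 then s m + g (y - T (s m), m) else 0.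
have sT n : q (y - T (s n)) <= q y * 2^-1 ^+ n.
  case: n => [|n]; first by rewrite /= (is_linear0 lT) subr0 expr0 mulr1.
  rewrite /= (is_linearD lT) opprD addrA.
  by apply: ltW; case: (gP (y - T (s n), n)).
have sC n k : p (s (k + n)%N - s n) <= C * 2 * q y * (2^-1 ^+ n - 2^-1 ^+ (k + n)).
  elim: k => [|k IH]; first by rewrite add0n !subrr (bnorm0 hp) mulr0.
  have := bnorm_tri hp (s (k + n)%N) (s (k.+1 + n)%N) (s n).
  have -> : s (k.+1 + n)%N - s (k + n)%N = g (y - T (s (k + n)%N), (k + n)%N).
    by rewrite addSn /= addrC addrA addNr add0r.
  have [+ _] := gP (y - T (s (k + n)%N), (k + n)%N) => /=.
  have := ler_wpM2l C0 (sT (k + n)%N).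
  rewrite addSn exprS; lra.
have E0 n : (0 : R) < 2^-1 ^+ n by rewrite exprn_gt0// invr_gt0.
have [||x xP] := bnorm_cvg_rate hp (u := s) (r := fun n => C * 2 * q y * 2^-1 ^+ n).
- by move=> e /half_pow_small; apply.
- move=> n m /subnK <-; apply: (le_trans (sC _ _)).
  rewrite ler_wpM2l ?mulr_ge0// ?(ltW y0)// gerBl ltW//.
exists x; last by have := xP 0; rewrite /= subr0 expr0 mulr1.
case: (bT) => _ [D D0 DP].
apply/esym/subr0_eq/(bnorm_eq0 hq)/le_anti; rewrite (bnorm_ge0 hq) andbT.
apply/ler_addgt0Pr => e e0; rewrite add0r.
(* In units of [2^-N], the first summand bounds the residual of [T (s N)], the second the distance
   from [T (s N)] to [T x]. *)
have [N Ne] := half_pow_small (q y + D * (C * 2 * q y)) e0.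
apply: le_trans (ltW Ne).
have := bnorm_tri hq (T (s N)) y (T x).
rewrite -(is_linearB lT); have := DP (s N - x).
rewrite (bnormC hp); have := ler_wpM2l D0 (xP N); have := sT N; lra.
Qed.
End Onto.
End OpenMapping.

(** * Right invertibility modulo finite rank *)

Section BlinTheory.
Variable R : realType.
Local Notation K := R[i].

Lemma blin_id (V : lmodType K) (p : V -> R) : blin p p id.
Proof. by split=> //; exists 1 => // x; rewrite mul1r. Qed.

Lemma blin_comp (V W Z : lmodType K) (p : V -> R) (q : W -> R) (s : Z -> R) f g :
  blin p q f -> blin q s g -> blin p s (g \o f).
Proof.
move=> [lf [C C0 fC]] [lg [D D0 gD]]; split=> [a x y|]; first by rewrite /= lf lg.
exists (D * C) => [|x]; first exact: mulr_ge0.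
by rewrite /= (le_trans (gD _))// -mulrA ler_wpM2l.
Qed.

Lemma blin0 (V W : lmodType K) (p : V -> R) (q : W -> R) :
  banach_norm q -> blin p q (fun=> 0).
Proof.
move=> hq; split=> [a x y|]; first by rewrite scaler0 addr0.
by exists 0 => // x; rewrite (bnorm0 hq) mul0r.
Qed.

Section Algebra.
Variables (V W : lmodType K) (p : V -> R) (q : W -> R).
Hypothesis hq : banach_norm q.

Lemma blinD f g : blin p q f -> blin p q g -> blin p q (fun x => f x + g x).
Proof.
move=> [lf [C C0 fC]] [lg [D D0 gD]]; split=> [a x y|].
  by rewrite lf lg scalerDr addrACA.
exists (C + D) => [|x]; first exact: addr_ge0.
by rewrite (le_trans (bnormD hq _ _))// mulrDl lerD.
Qed.

Lemma blinN f : blin p q f -> blin p q (fun x => - f x).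
Proof.
move=> [lf [C C0 fC]]; split=> [a x y|]; first by rewrite lf opprD scalerN.
by exists C => // x; rewrite (bnormN hq).
Qed.

Lemma blinB f g : blin p q f -> blin p q g -> blin p q (fun x => f x - g x).
Proof. by move=> bf bg; apply: blinD => //; exact: blinN. Qed.

Lemma blin_sum (I : Type) (s : seq I) (P : pred I) (f : I -> V -> W) :
  (forall i, P i -> blin p q (f i)) -> blin p q (fun x => \sum_(i <- s | P i) f i x).
Proof.
move=> bf; elim: s => [|i s IH].
  by under eq_fun do rewrite big_nil; exact: blin0.
have [Pi|Pi] := boolP (P i); last by under eq_fun do rewrite big_cons (negbTE Pi).
by under eq_fun do rewrite big_cons Pi; apply: blinD => //; exact: bf.
Qed.

Lemma blin_smul (c : V -> K^o) (w : W) :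
  blin p (@cmod R : K^o -> R) c -> blin p q (fun x => (c x : K) *: w).
Proof.
move=> [lc [C C0 cC]]; split=> [a x y|].
  by rewrite lc scalerDl -scalerA.
exists (C * q w) => [|x]; first by rewrite mulr_ge0// (bnorm_ge0 hq).
by rewrite (bnormZ hq) mulrAC ler_wpM2r// (bnorm_ge0 hq).
Qed.
End Algebra.

Section Product.
Variables (V W : lmodType K) (p : V -> R) (q : W -> R).
Hypotheses (hp : banach_norm p) (hq : banach_norm q).

(** Serves to adjoin one scalar coordinate to the domain of an operator, with [K^o] as second
    factor. *)
Definition prod_bnorm (x : V * W) : R := p x.1 + q x.2.

Lemma prod_banach : banach_norm prod_bnorm.
Proof.
have p0 := bnorm_ge0 hp; have q0 := bnorm_ge0 hq.
split=> [[x y] [x' y']|a [x y]|[x y] /eqP|u cu].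
- by rewrite /prod_bnorm /= [leRHS]addrACA; apply: lerD; [exact: bnormD hp _ _|exact: bnormD hq _ _].
- by rewrite /prod_bnorm /= (bnormZ hp) (bnormZ hq) mulrDr.
- rewrite /prod_bnorm /= paddr_eq0// => /andP[/eqP /(bnorm_eq0 hp) ->].
  by move=> /eqP /(bnorm_eq0 hq) ->.
have [|x ux] := bnorm_complete hp (u := fun n => (u n).1).
  move=> e /cu[N uN]; exists N => n m nN mN.
  by apply: le_lt_trans (uN n m nN mN); rewrite lerDl.
have [|y uy] := bnorm_complete hq (u := fun n => (u n).2).
  move=> e /cu[N uN]; exists N => n m nN mN.
  by apply: le_lt_trans (uN n m nN mN); rewrite lerDr.
exists (x, y) => e e0; have e20 : 0 < e / 2 by lra.
have [N uN] := ux _ e20; have [M uM] := uy _ e20.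
exists (maxn N M) => n; rewrite geq_max => /andP[/uN + /uM].
rewrite /prod_bnorm /=; lra.
Qed.

Lemma blin_fst : blin prod_bnorm p fst.
Proof. by split=> //; exists 1 => // x; rewrite mul1r lerDl (bnorm_ge0 hq). Qed.

Lemma blin_snd : blin prod_bnorm q snd.
Proof. by split=> //; exists 1 => // x; rewrite mul1r lerDr (bnorm_ge0 hp). Qed.

Lemma blin_inl : blin p prod_bnorm (fun x => (x, 0)).
Proof.
split=> [a x y|]; first by rewrite -[RHS]/(_, _) /= scaler0 addr0.
by exists 1 => // x; rewrite /prod_bnorm /= (bnorm0 hq) addr0 mul1r.
Qed.
End Product.

(** Sums of bounded rank-one operators, with no independence required, so that inductions can remove
    one term at a time. *)
Inductive finrank (V W : lmodType K) (p : V -> R) : (V -> W) -> Prop :=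
| finrank0 : finrank p (fun=> 0)
| finrankS F (c : V -> K^o) w : finrank p F -> blin p (@cmod R : K^o -> R) c ->
    finrank p (fun x => F x + (c x : K) *: w).

Lemma finrank_post (V W Z : lmodType K) (p : V -> R) (F : V -> W) (L : W -> Z) :
  is_linear L -> finrank p F -> finrank p (L \o F).
Proof.
move=> lL; elim=> [|G c w _ IH bc].
  rewrite (_ : _ \o _ = fun=> 0); first exact: finrank0.
  by apply/funext => x /=; rewrite is_linear0.
rewrite (_ : _ \o _ = fun x => (L \o G) x + (c x : K) *: L w); first exact: finrankS.
by apply/funext => x /=; rewrite is_linearD// is_linearZ.
Qed.

Lemma finrank_pre (V W Z : lmodType K) (p : V -> R) (q : W -> R) (F : W -> Z) (S : V -> W) :
  blin p q S -> finrank q F -> finrank p (F \o S).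
Proof.
move=> bS; elim=> [|G c w _ IH bc]; first exact: finrank0.
exact: (finrankS w IH (blin_comp bS bc)).
Qed.

Lemma finrankD (V W : lmodType K) (p : V -> R) (F G : V -> W) :
  finrank p F -> finrank p G -> finrank p (fun x => F x + G x).
Proof.
move=> fF; elim=> [|H c w _ IH bc]; first by under eq_fun do rewrite addr0.
by under eq_fun do rewrite addrA; exact: finrankS.
Qed.

Lemma finrank_sum (V W : lmodType K) (p : V -> R) (I : Type) (s : seq I) (F : I -> V -> W) :
  (forall i, finrank p (F i)) -> finrank p (fun x => \sum_(i <- s) F i x).
Proof.
move=> fF; elim: s => [|i s IH].
  by under eq_fun do rewrite big_nil; exact: finrank0.
by under eq_fun do rewrite big_cons; exact: finrankD.
Qed.

(* [almost_sub U M]: U is contained in M + (a finite-dimensional space). *)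
Inductive almost_sub (V : lmodType K) (U : set V) : set V -> Prop :=
| almost_sub0 M : U `<=` M -> almost_sub U M
| almost_subS M w : almost_sub U [set y | exists a : K, M (y - a *: w)] ->
    almost_sub U M.

Definition right_invertible_mod (V W : lmodType K) (p : V -> R) (q : W -> R) (T : V -> W) :=
  exists S F, [/\ blin q p S, finrank q F & forall y, T (S y) = y - F y].

Definition bcomplemented (V : lmodType K) (p : V -> R) (M : set V) :=
  exists P : V -> V, blin p p P /\ (forall x, P (P x) = P x) /\ range P = M.

Section Atkinson.
Variables (V W : lmodType K) (p : V -> R) (q : W -> R) (T : V -> W).
Hypotheses (hp : banach_norm p) (hq : banach_norm q) (bT : blin p q T).

(** Each rank-one term of [F] costs one direction: dropping the term along [w] enlarges [M] to
    [M + K w]. *)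
Lemma finrank_range_almost_sub (M : set W) (F : W -> W) :
  finrank q F -> (forall y, M (y - F y)) -> almost_sub setT M.
Proof.
move=> fF; elim: fF M => [|G c w _ IH bc] M MF.
  by apply: almost_sub0 => y _; rewrite -[y]subr0; exact: MF.
apply: (almost_subS (w := w)); apply: IH => y; exists (c y).
by rewrite -addrA -opprD.
Qed.

(* If T S = 1 - F, then (1 - S T) E is a projection onto ker T. *)
Lemma finrank_kernel_retract (F : W -> W) : finrank q F ->
  exists E : V -> V, [/\ blin p p E, forall x, F (T (E x)) = 0 &
                        forall x, T x = 0 -> E x = x].
Proof.
have [lT _] := bT; elim=> [|G c w _ [E [bE GE TE]] bc].
  by exists id; split=> //; exact: blin_id.
pose phi := c \o (T \o E).
have bphi : blin p (@cmod R : K^o -> R) phi by apply: blin_comp bc; exact: blin_comp bT.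
have [phi0|] := pselect (forall x, phi x = 0).
  by exists E; split=> // x; rewrite GE add0r (phi0 x : c (T (E x)) = 0) scale0r.
move=> /existsNP[v0 /eqP nv0]; pose v := (phi v0)^-1 *: v0.
have [lE _] := bE; have [lphi _] := bphi; have [lc _] := bc.
have phiv : phi v = 1 by rewrite (is_linearZ lphi) [LHS]mulVf.
(* This is [E] applied to [x - phi x *: v], on which [phi] vanishes because [phi v = 1]. On the
   kernel of [T], [phi] is zero, so its vectors remain fixed. *)
exists (fun x => E x - (phi x : K) *: E v); split.
- by apply: blinB => //; exact: blin_smul.
- move=> x; rewrite -(is_linearZ lE) -(is_linearB lE) GE add0r.
  rewrite -[c _]/(phi (x - _)) (is_linearB lphi) (is_linearZ lphi) phiv.
  by rewrite [_ *: 1]mulr1 subrr scale0r.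
- by move=> x Tx; rewrite TE// /phi /= TE// Tx (is_linear0 lc) scale0r subr0.
Qed.

Lemma right_invertible_mod_complemented :
  right_invertible_mod p q T -> bcomplemented p [set x | T x = 0].
Proof.
move=> [S [F [bS fF TS]]]; have [E [bE FE TE]] := finrank_kernel_retract fF.
have [lT _] := bT; have [lS _] := bS.
have TP x : T (E x - S (T (E x))) = 0.
  by rewrite (is_linearB lT) TS FE subr0 subrr.
have PT x : T x = 0 -> E x - S (T (E x)) = x.
  by move=> Tx; rewrite TE// Tx (is_linear0 lS) subr0.
exists (fun x => E x - S (T (E x))); split.
  by apply: blinB => //; exact: (blin_comp (blin_comp bE bT) bS).
split=> [x|]; first exact: PT.
by apply/seteqP; split=> [_ [x _ <-]|x Tx] //=; exists x => //; exact: PT.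
Qed.

End Atkinson.

(** The bounded lifting [g] need not be linear. Subtracting its projection to the kernel selects the
    only preimage killed by [P], and this uniqueness forces linearity. *)
Lemma onto_right_inverse (V W : lmodType K) (p : V -> R) (q : W -> R) (T : V -> W) :
  banach_norm p -> banach_norm q -> blin p q T ->
  bcomplemented p [set x | T x = 0] -> (forall y, exists x, T x = y) ->
  exists2 S, blin q p S & forall y, T (S y) = y.
Proof.
move=> hp hq bT [P [[lP [D D0 PD]] [PP rP]]] onto; have [lT _] := bT.
have TP x : T (P x) = 0 by have : range P (P x) by []; rewrite rP.
have PT x : T x = 0 -> P x = x.
  by move=> Tx; have : [set x | T x = 0] x by []; rewrite -rP => -[z _ <-].
have [C C0 CP] := bounded_lifting hp hq bT onto.
have /choice[g gP] y : exists x, T x = y /\ p x <= C * q y.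
  by have [x] := CP y; exists x.
have inj x x' : T x = T x' -> P x = 0 -> P x' = 0 -> x = x'.
  move=> Txx' Px Px'; apply/subr0_eq; rewrite -(PT (x - x')).
    by rewrite (is_linearB lP) Px Px' subr0.
  by rewrite (is_linearB lT) Txx' subrr.
pose S y := g y - P (g y).
have TS y : T (S y) = y by rewrite (is_linearB lT) TP subr0; case: (gP y).
have PS y : P (S y) = 0 by rewrite (is_linearB lP) PP subrr.
exists S => //; split=> [a x y|].
  by apply: inj; rewrite ?lT ?lP ?TS ?PS// scaler0 addr0.
exists ((1 + D) * C) => [|y]; first by rewrite mulr_ge0// addr_ge0.
rewrite -mulrA (le_trans (bnormB hp _ _))// mulrDl mul1r.
have [_ gy] := gP y; rewrite lerD// (le_trans (PD _))//.
by rewrite ler_wpM2l.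
Qed.

(** The hard half of Atkinson's description, by induction on the directions missing from the range.
    A missing [w] is supplied by the operator [(x, a) |-> T x + a w]; the scalar component of its
    regularizer then becomes one more rank-one error for [T]. *)
Lemma complemented_right_invertible_mod (V W : lmodType K) (p : V -> R) (q : W -> R)
    (T : V -> W) :
  banach_norm p -> banach_norm q -> blin p q T ->
  bcomplemented p [set x | T x = 0] -> almost_sub setT (range T) ->
  right_invertible_mod p q T.
Proof.
(* The domain, its norm and [T] stay general in the induction, since the step replaces [V] by
   [V * K^o]. *)
move=> + hq + + aM; move: aM; move EM : (range T) => M aM.
elim: aM V p T EM => [{}M subM|{}M w _ IH] V p T EM hp bT cT.
  have [|S bS TS] := onto_right_inverse hp hq bT cT.
    by move=> y; have := subM y I; rewrite -EM => -[x _ <-]; exists x.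
  exists S, (fun=> 0); split=> //; first exact: finrank0.
  by move=> y; rewrite subr0.
have [lT _] := bT.
(* If [w] is already in the range, then [M + K w = M] and the induction hypothesis applies to [T]
   itself. Otherwise the enlarged operator has kernel [ker T * 0]. *)
have [wM|wM] := pselect (M w).
  apply: IH => //; rewrite EM; move: wM; rewrite -EM => -[v _ <-].
  apply/seteqP; split=> [_ [x _ <-]|y [a [x _ Tx]]].
    by exists 0; rewrite scale0r subr0; exists x.
  exists (x + a *: v) => //; rewrite (is_linearD lT) (is_linearZ lT) Tx.
  by rewrite subrK.
pose That (xa : V * K^o) := T xa.1 + (xa.2 : K) *: w.
have hpK := prod_banach hp (cmod_banach R).
have bThat : blin (prod_bnorm p (@cmod R : K^o -> R)) q That.
  apply: (blinD hq).
    by apply: (blin_comp (blin_fst _ (cmod_banach R)) bT).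
  by apply: (blin_smul hq); exact: blin_snd.
have [|//||S [F [bS fF TS]]] := IH _ _ That _ hpK.
- apply/seteqP; split=> [_ [[x a] _ <-]|y [a]].
    by exists a; rewrite /That /= addrK -EM; exists x.
  by rewrite -EM => -[x _ Tx]; exists (x, a) => //; rewrite /That /= Tx subrK.
- have [P [bP [PP rP]]] := cT.
  exists (fun xa => (P xa.1, 0)); split; last split.
  + exact: (blin_comp (blin_comp (blin_fst _ (cmod_banach R)) bP) (blin_inl _ (cmod_banach R))).
  + by move=> xa /=; rewrite PP.
  apply/seteqP; split=> [_ [xa _ <-]|[x a]] /=.
    rewrite /That /= scale0r addr0.
    by have : range P (P xa.1) by []; rewrite rP.
  rewrite /That /= => Txa; have [a0|a0] := eqVneq a 0.
    move: Txa; rewrite a0 scale0r addr0 => Tx.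
    have : [set x | T x = 0] x by []; rewrite -rP => -[z _ <-].
    by exists (z, 0).
  (* A kernel vector with [a != 0] would exhibit [w] as a value of [T]. *)
  exfalso; apply: wM; rewrite -EM; exists (- a^-1 *: x) => //.
  rewrite (is_linearZ lT) scaleNr -scalerN; apply: (scalerI a0).
  rewrite scalerA mulfV// scale1r; apply/eqP.
  by rewrite eq_sym -addr_eq0 addrC Txa.
exists (fst \o S), (fun y => F y + ((S y).2 : K) *: w); split.
- exact: (blin_comp bS (blin_fst _ (cmod_banach R))).
- by apply: finrankS => //; exact: (blin_comp bS (blin_snd _ hp)).
by move=> y /=; rewrite opprD addrA -TS /That addrK.
Qed.

End BlinTheory.

(** * The direct sum *)

Section DirectSumNorm.
Variable R : realType.
Local Notation K := R[i].
Variable n : nat.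
Variable X : 'I_n -> completeNormedModType K.
Local Notation E := (dsum X).

Lemma dsumD (x y : E) i : (x + y) i = x i + y i. Proof. by []. Qed.
Lemma dsumZ a (x : E) i : (a *: x) i = a *: x i. Proof. by []. Qed.

Lemma dsum_sumE (I : Type) (s : seq I) (P : pred I) (F : I -> E) i :
  (\sum_(j <- s | P j) F j) i = \sum_(j <- s | P j) F j i.
Proof. exact: (big_morph (fun x : E => x i)). Qed.

Definition dsingle (i : 'I_n) (y : X i) : E := dfwith (0 : E) i y.

Lemma dsingle_in i y : dsingle y i = y. Proof. exact: dfwithin. Qed.
Lemma dsingle_out i (y : X i) j : i != j -> dsingle y j = 0.
Proof. by move=> ij; rewrite /dsingle dfwithout// eq_sym. Qed.

Lemma dsingle_linear i : is_linear (@dsingle i).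
Proof.
move=> a x y; apply: functional_extensionality_dep => j; rewrite dsumD dsumZ.
have [<-|ij] := eqVneq i j; first by rewrite !dsingle_in.
by rewrite !dsingle_out// scaler0 addr0.
Qed.

Lemma dsum_decomp (x : E) : x = \sum_i dsingle (x i).
Proof.
apply: functional_extensionality_dep => j; rewrite dsum_sumE (bigD1 j)//= dsingle_in.
by rewrite big1 ?addr0// => i; exact: dsingle_out.
Qed.

Definition dnorm (x : E) : R := \sum_i rnorm (x i).

Lemma rnorm_ge0 i (x : X i) : 0 <= rnorm x.
Proof. exact: (bnorm_ge0 (rnorm_banach _)). Qed.

Lemma rnorm_le_dnorm (x : E) i : rnorm (x i) <= dnorm x.
Proof.
by rewrite /dnorm (bigD1 i)//= lerDl sumr_ge0// => j _; exact: rnorm_ge0.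
Qed.

Lemma dnorm_banach : banach_norm dnorm.
Proof.
split=> [x y|a x|x x0|u cu].
- rewrite -big_split; apply: ler_sum => i _.
  exact: (bnormD (rnorm_banach (X i)) (x i) (y i)).
- rewrite /dnorm mulr_sumr; apply: eq_bigr => i _.
  exact: (bnormZ (rnorm_banach (X i)) a (x i)).
- apply: functional_extensionality_dep => i.
  apply: (bnorm_eq0 (rnorm_banach (X i))); apply/le_anti.
  by rewrite rnorm_ge0 andbT -x0 rnorm_le_dnorm.
have ex i : exists xi, norm_cvg (@rnorm R (X i)) (fun k => u k i) xi.
  apply: (bnorm_complete (rnorm_banach (X i))) => e /cu[N uN].
  exists N => k m Nk Nm; apply: le_lt_trans (uN _ _ Nk Nm).
  exact: (rnorm_le_dnorm (u m - u k) i).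
pose x : E := fun i => projT1 (cid (ex i)).
have ux i : norm_cvg (@rnorm R (X i)) (fun k => u k i) (x i) := projT2 (cid (ex i)).
(* Dividing by [n.+1] keeps the sum of the [n] errors strictly below [e] and also covers [n = 0]. *)
exists x => e e0; have d0 : 0 < e / n.+1%:R by rewrite divr_gt0.
have /choice[N NP] i := ux i _ d0.
exists (\max_i N i) => k Nk; rewrite /dnorm.
apply: (@le_lt_trans _ _ (\sum_(i < n) e / n.+1%:R)).
  by apply: ler_sum => i _; apply/ltW/NP/(leq_trans _ Nk)/leq_bigmax.
rewrite sumr_const card_ord -[_ *+ n]mulr_natr mulrAC ltr_pdivrMr//.
by rewrite ltr_pM2l// ltr_nat.
Qed.

Lemma blin_proj i : blin dnorm (@rnorm R (X i)) (fun x : E => x i).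
Proof. by split=> //; exists 1 => // x; rewrite mul1r rnorm_le_dnorm. Qed.

Lemma dnorm_dsingle i (y : X i) : dnorm (dsingle y) = rnorm y.
Proof.
rewrite /dnorm (bigD1 i)//= dsingle_in big1 ?addr0// => j ij.
by rewrite dsingle_out 1?eq_sym// (bnorm0 (rnorm_banach _)).
Qed.

Lemma blin_dsingle i : blin (@rnorm R (X i)) dnorm (@dsingle i).
Proof.
by split; [exact: dsingle_linear|exists 1 => // y; rewrite mul1r dnorm_dsingle].
Qed.

Lemma blin_pi (V : lmodType K) (p : V -> R) (f : V -> E) :
  (forall i, blin p (@rnorm R (X i)) (fun x => f x i)) -> blin p dnorm f.
Proof.
move=> bf; rewrite (_ : f = fun x => \sum_i dsingle (f x i)).
  apply: (blin_sum dnorm_banach) => i _; exact: (blin_comp (bf i) (@blin_dsingle i)).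
by apply/funext => x; exact: dsum_decomp.
Qed.

Lemma continuous_dsingle i : continuous (@dsingle i : X i -> E).
Proof. exact: dfwith_continuous. Qed.

Lemma continuous_proj i : continuous (fun x : E => x i).
Proof. exact: proj_continuous. Qed.

Lemma continuous_pi (T : topologicalType) (f : T -> E) :
  (forall i, continuous (fun x => f x i)) -> continuous f.
Proof.
move=> cf x; apply/cvg_sup => i.
apply: (@continuous_comp_initial _ _ _ (@proj _ (fun i => X i) i) f).
exact: cf.
Qed.

(** Both sides reduce to the matrix entries [f (dsingle x) i], which act between normed modules,
    where [bounded_op_blin] applies; [f] is a finite sum of them. *)
Lemma bounded_op_dsum (f : E -> E) : bounded_op f <-> blin dnorm dnorm f.
Proof.
have part i j : is_linear f -> continuous (fun x : X j => f (dsingle x) i) <->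
    blin (@rnorm R (X j)) (@rnorm R (X i)) (fun x => f (dsingle x) i).
  move=> lf; rewrite -bounded_op_blin; split=> [cf|[]//]; split=> // a x y.
  by rewrite dsingle_linear lf.
have fE (lf : is_linear f) i : (fun x => f x i) = fun x => \sum_j f (dsingle (x j)) i.
  by apply/funext => x; rewrite {1}[x]dsum_decomp (is_linear_sum lf) dsum_sumE.
split=> [[lf cf]|bf].
  apply: blin_pi => i; rewrite fE//; apply: (blin_sum (rnorm_banach _)) => j _.
  apply: (blin_comp (g := fun y => f (dsingle y) i) (blin_proj j)).
  apply/(part i j lf) => x; apply: (@continuous_comp _ _ _ (f \o @dsingle j) (fun z : E => z i)).
    by apply: continuous_comp; [exact: continuous_dsingle|exact: cf].
  exact: continuous_proj.
have [lf _] := bf; split=> //; apply: continuous_pi => i; rewrite fE//.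
apply: continuous_big => [|j _ x]; first exact: add_continuous.
apply: (@continuous_comp _ _ _ (fun x : E => x j) (fun y => f (dsingle y) i)).
  exact: continuous_proj.
have := blin_comp (@blin_dsingle j) (blin_comp bf (blin_proj i)).
by move=> /(part i j lf); apply.
Qed.

End DirectSumNorm.

(** * Finite codimension *)

Section AlmostSub.
Variable R : realType.
Local Notation K := R[i].

Definition linear_subspace (V : lmodType K) (M : set V) :=
  M 0 /\ forall (a : K) x y, M x -> M y -> M (a *: x + y).

Section Calculus.
Variable V : lmodType K.
Implicit Types U M N B : set V.

Lemma almost_sub_subl U U' M : U' `<=` U -> almost_sub U M -> almost_sub U' M.
Proof.
move=> sU; elim=> [{}M UM|{}M w _]; last exact: almost_subS.
by apply: almost_sub0 => x /sU /UM.
Qed.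

Lemma almost_sub_subr U M M' : M `<=` M' -> almost_sub U M -> almost_sub U M'.
Proof.
move=> + aM; elim: aM M' => [{}M UM M' MM'|{}M w _ IH M' MM'].
  by apply: almost_sub0 => x /UM /MM'.
by apply: (almost_subS (w := w)); apply: IH => y [a /MM' ?]; exists a.
Qed.

(** The two sets are the sums [B + M] and [N + M]. *)
Lemma almost_sub_add B N M : almost_sub B N ->
  almost_sub [set y | exists2 b, B b & M (y - b)] [set y | exists2 b, N b & M (y - b)].
Proof.
elim=> [{}N BN|{}N w _ IH]; first by apply: almost_sub0 => y [b /BN ? ?]; exists b.
apply: (almost_subS (w := w)); apply: almost_sub_subr IH => y [b [a Nb] Mb].
by exists a, (b - a *: w) => //; rewrite opprB addrA subrK.
Qed.

Lemma almost_sub_shift M M' w : almost_sub M M' ->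
  almost_sub [set y | exists a : K, M (y - a *: w)] [set y | exists a : K, M' (y - a *: w)].
Proof.
elim=> [{}M' MM'|{}M' w' _ IH].
  by apply: almost_sub0 => y [a /MM' ?]; exists a.
apply: (almost_subS (w := w')); apply: almost_sub_subr IH => y [a [b Mab]].
by exists b, a; rewrite addrAC.
Qed.

Lemma almost_sub_trans M U M' : almost_sub U M -> almost_sub M M' -> almost_sub U M'.
Proof.
move=> aM; elim: aM M' => [{}M UM M'|{}M w _ IH M' aM']; first exact: almost_sub_subl.
by apply: (almost_subS (w := w)); apply: IH; exact: almost_sub_shift.
Qed.

Lemma subspace_shift M w :
  linear_subspace M -> linear_subspace [set y | exists a : K, M (y - a *: w)].
Proof.
move=> [M0 MD]; split=> [|a x y [b Mx] [c My]]; first by exists 0; rewrite scale0r subr0.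
exists (a * b + c); have := MD a _ _ Mx My.
by rewrite scalerBr scalerA addrACA -opprD -scalerDl.
Qed.

(** The extra directions can be taken inside [U]. If [U] meets [M + K w] outside [M], a vector [u]
    found there replaces [w]; if not, [w] adds nothing to the intersection. *)
Lemma almost_subI U M : linear_subspace U -> linear_subspace M -> almost_sub U M ->
  almost_sub U (M `&` U).
Proof.
move=> sU + aM; have [_ UD] := sU.
elim: aM => [{}M UM sM|{}M w _ IH sM]; first by apply: almost_sub0 => x Ux; split; [exact: UM|].
apply: almost_sub_trans (IH (subspace_shift w sM)) _; have [_ MD] := sM.
have [[u [a [Uu Ma a0]]]|nex] :=
    pselect (exists u, exists a, [/\ U u, M (u - a *: w) & a != 0]).
  apply: (almost_subS (w := u)); apply: almost_sub0 => x [[b Mb] Ux].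
  (* The multiple of [u] that cancels the [w]-component of [x]. *)
  exists (b / a); split; last by rewrite addrC -scaleNr; exact: UD.
  have := MD (- (b / a)) _ _ Ma Mb.
  by rewrite scalerBr scalerA mulNr mulfVK// !scaleNr opprK addrC addrA addrAC subrK.
apply: almost_sub0 => x [[b Mb] Ux]; split=> //.
have [b0|b0] := eqVneq b 0; first by move: Mb; rewrite b0 scale0r subr0.
by exfalso; apply: nex; exists x, b.
Qed.
End Calculus.

Lemma almost_sub_image (V W : lmodType K) (f : V -> W) (U M : set V) :
  is_linear f -> almost_sub U M -> almost_sub (f @` U) (f @` M).
Proof.
move=> lf; elim=> [{}M UM|{}M w _ IH].
  by apply: almost_sub0 => _ [x /UM ? <-]; exists x.
apply: (almost_subS (w := f w)); apply: almost_sub_subr IH => _ [x [a Mx] <-].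
by exists a, (x - a *: w) => //; rewrite (is_linearB lf) (is_linearZ lf).
Qed.

Lemma image_subspace (V W : lmodType K) (f : V -> W) (M : set V) :
  is_linear f -> linear_subspace M -> linear_subspace (f @` M).
Proof.
move=> lf [M0 MD]; split; first by exists 0; rewrite // (is_linear0 lf).
by move=> a _ _ [x Mx <-] [y My <-]; exists (a *: x + y); [exact: MD|exact: lf].
Qed.

Lemma spanned_almost_sub (V : lmodType K) (U M : set V) m (w : 'I_m -> V) :
  (forall y, U y -> exists s (c : 'I_m -> K), M s /\ y = s + \sum_i c i *: w i) ->
  almost_sub U M.
Proof.
elim: m M w => [M w UM|m IH M w UM].
  by apply: almost_sub0 => y /UM[s [c [Ms ->]]]; rewrite big_ord0 addr0.
apply: (almost_subS (w := w ord0)); apply: (IH _ (fun i => w (lift ord0 i))) => y /UM[s [c [Ms ->]]].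
exists (s + c ord0 *: w ord0), (fun i => c (lift ord0 i)).
by split; [exists (c ord0); rewrite addrK|rewrite big_ord_recl addrA].
Qed.

Lemma least_natP (P : nat -> Prop) : least_nat P <> einf <-> exists n, P n.
Proof. by rewrite /least_nat; case: pselect. Qed.

Lemma betaP (V W : preTopologicalLmodType K) (T : V -> W) :
  beta T <> einf <-> almost_sub setT (range T).
Proof.
rewrite least_natP; split=> [[m [w wP]]|].
  by apply: (spanned_almost_sub (w := w)) => y _; exact: wP.
elim=> [M UM|M w _ [m [v vP]]].
  by exists 0%N, (fun=> 0) => y; exists y, (fun=> 0); rewrite big_ord0 addr0; split=> //; exact: UM.
exists m.+1, (fun i => oapp v w (unlift ord0 i)) => y.
have [s [c [[a Ms] ->]]] := vP y.
exists (s - a *: w), (fun i => oapp c a (unlift ord0 i)); split=> //.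
rewrite big_ord_recl unlift_none /= addrA subrK; congr (_ + _).
by apply: eq_bigr => i _; rewrite liftK.
Qed.

Lemma alpha_almost_sub (V W : preTopologicalLmodType K) (T : V -> W) :
  alpha T <> einf -> almost_sub [set x | T x = 0] [set 0].
Proof.
move=> /least_natP[m [v [_ vP]]]; apply: (spanned_almost_sub (w := v)) => y /vP[c ->].
by exists 0, c; rewrite add0r.
Qed.

(** Atkinson's description. The norm is linked to the topology only through the bounded operators,
    so the result covers both the spaces [X k] and [dsum X]. *)
Lemma right_fredholmP (V : preTopologicalLmodType K) (p : V -> R) (T : V -> V) :
  banach_norm p -> (forall f : V -> V, bounded_op f <-> blin p p f) ->
  bounded_op T -> right_fredholm T <-> right_invertible_mod p p T.
Proof.
move=> hp bop /bop bT; have cE M : complemented M <-> bcomplemented p M.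
  by split=> -[P [/bop bP ?]]; exists P.
split=> [[/betaP aT /cE cT]|rT].
  exact: complemented_right_invertible_mod.
split; last by apply/cE; exact: (right_invertible_mod_complemented hp bT).
apply/betaP; have [S [F [_ fF TS]]] := rT.
by apply: (finrank_range_almost_sub fF) => y; exists (S y); rewrite // TS.
Qed.

End AlmostSub.

(** * Upper triangular operator matrices *)

Section Triangular.
Variable R : realType.
Local Notation K := R[i].
Variable n : nat.
Variable X : 'I_n -> completeNormedModType K.
Local Notation E := (dsum X).
Variables (D : forall k : 'I_n, X k -> X k) (A : forall i j : 'I_n, X j -> X i).
Arguments D : clear implicits.
Arguments A : clear implicits.
Hypothesis bD : forall k, blin (@rnorm R (X k)) (@rnorm R (X k)) (D k).
Hypothesis bA : forall i j : 'I_n, (i < j)%N -> blin (@rnorm R (X j)) (@rnorm R (X i)) (A i j).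

Lemma blin_row (i : 'I_n) :
  blin (@dnorm R n X) (@rnorm R (X i)) (fun x => \sum_(j < n | (i < j)%N) A i j (x j)).
Proof.
apply: (blin_sum (rnorm_banach _)) => j ij.
exact: (blin_comp (blin_proj X j) (bA ij)).
Qed.

Lemma blin_Tnd : blin (@dnorm R n X) (@dnorm R n X) (Tnd D A).
Proof.
apply: blin_pi => i; apply: (blinD (rnorm_banach _)); last exact: blin_row.
exact: (blin_comp (blin_proj X i) (bD i)).
Qed.

(* Back-substitution: the i-th coordinate is final after n - i rounds. *)
Lemma Tnd_right_invertible_mod :
  (forall k, right_invertible_mod (@rnorm R (X k)) (@rnorm R (X k)) (D k)) ->
  right_invertible_mod (@dnorm R n X) (@dnorm R n X) (Tnd D A).
Proof.
move=> rD; pose S k := projT1 (cid (rD k)).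
pose F k := projT1 (cid (projT2 (cid (rD k)))).
have SF k : [/\ blin (@rnorm R (X k)) (@rnorm R (X k)) (S k),
    finrank (@rnorm R (X k)) (F k) & forall y, D k (S k y) = y - F k y].
  exact: (projT2 (cid (projT2 (cid (rD k))))).
pose res (y x : E) i := y i - \sum_(j < n | (i < j)%N) A i j (x j).
(* Each round solves all rows simultaneously, using the previous round for the entries above the
   diagonal. *)
pose s := fix s t (y : E) : E := if t is t'.+1 then fun i => S i (res y (s t' y) i) else 0.
have bres t i : blin (@dnorm R n X) (@dnorm R n X) (s t) ->
    blin (@dnorm R n X) (@rnorm R (X i)) (fun y => res y (s t y) i).
  move=> bs; apply: (blinB (rnorm_banach _)); first exact: (blin_proj X i).
  exact: (blin_comp bs (blin_row i)).
have bs t : blin (@dnorm R n X) (@dnorm R n X) (s t).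
  elim: t => [|t IH]; first exact: (blin0 _ (dnorm_banach X)).
  apply: blin_pi => i; have [bS _ _] := SF i.
  exact: (blin_comp (bres t i IH) bS).
have sfix t y (i : 'I_n) : (n <= t + i)%N -> s t.+1 y i = s t y i.
  elim: t i => [i|t IH i ni]; first by rewrite add0n leqNgt ltn_ord.
  congr (S i (_ - _)); apply: eq_bigr => j ij; congr (A i j _); apply: IH.
  by rewrite (leq_trans ni)// addSnnS leq_add2l.
exists (s n), (fun y => \sum_i dsingle (F i (res y (s n y) i))); split=> //.
  apply: finrank_sum => i; have [_ fF _] := SF i.
  apply: (finrank_post (dsingle_linear (i := i))).
  exact: (finrank_pre (bres n i (bs n)) fF).
move=> y; apply: functional_extensionality_dep => i.
rewrite -[RHS]/(y i - (\sum_i0 dsingle _) i) dsum_sumE (bigD1 i)//= dsingle_in.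
rewrite big1 ?addr0; last by move=> j; exact: dsingle_out.
(* After [n] rounds one more changes nothing, so coordinate [i] has the form
   [S i (res y (s n y) i)], to which the identity for [D i] applies. *)
rewrite /Tnd -sfix ?leq_addr//= -/(res y (s n y) i).
have [_ _ ->] := SF i; rewrite addrAC; congr (_ - _).
by rewrite /res subrK.
Qed.

(** The last row of the matrix contains only [D m], so the last coordinate of [T S = 1 - F] on
    [dsingle y] is an identity for [D m] alone. *)
Lemma last_right_invertible_mod (m : 'I_n) : m = n.-1 :> nat ->
  right_invertible_mod (@dnorm R n X) (@dnorm R n X) (Tnd D A) ->
  right_invertible_mod (@rnorm R (X m)) (@rnorm R (X m)) (D m).
Proof.
move=> mn [S [F [bS fF TS]]].
exists (fun y => S (dsingle y) m), (fun y => F (dsingle y) m); split.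
- exact: (blin_comp (blin_comp (blin_dsingle X m) bS) (blin_proj X m)).
- have lm : is_linear (fun x : E => x m) by have [] := blin_proj X m.
  exact: (finrank_post lm (finrank_pre (blin_dsingle X m) fF)).
move=> y; have /(congr1 (fun x : E => x m)) := TS (dsingle y).
rewrite -[X in _ = X -> _]/(dsingle y m - F (dsingle y) m) dsingle_in => <- /=.
rewrite /Tnd big1 ?addr0// => j; rewrite mn ltnNge -ltnS prednK ?ltn_ord//.
exact: leq_ltn_trans (ltn_ord m).
Qed.

(** The bound is inclusive: coordinate [k] itself may be nonzero. *)
Definition low (k : nat) : set E := [set x | forall s : 'I_n, (k < s)%N -> x s = 0].

Lemma low_subspace k : linear_subspace (low k).
Proof.
split=> [//|a x y lx ly s ks]; rewrite dsumD dsumZ.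
by rewrite lx// ly// scaler0 addr0.
Qed.

Lemma Tnd_low_coord (k : 'I_n) x : low k x -> Tnd D A x k = D k (x k).
Proof.
move=> lx; rewrite /Tnd big1 ?addr0// => j kj; rewrite lx//.
by rewrite (is_linear0 (bA kj).1).
Qed.

(** If [x] is in [low k] and its image in [low k.-1], then [D k (x k) = 0]. Splitting off
    [dsingle (x k)] writes the image as a vector of the finite-dimensional space
    [T (dsingle (ker D_k))] plus one of [T (low k.-1)]. *)
Lemma almost_sub_low_step (k : 'I_n) : (0 < k)%N ->
  almost_sub [set x | D k x = 0] [set 0] ->
  almost_sub (low k) (Tnd D A @` low k) ->
  almost_sub (low k.-1) (Tnd D A @` low k.-1).
Proof.
move=> k0 kerD aM; have [lT _] := blin_Tnd.
have lowS : low k.-1 `<=` low k.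
  by move=> x lx s ks; apply: lx; rewrite (leq_ltn_trans (leq_pred _)).
have := almost_subI (low_subspace k.-1) (image_subspace lT (low_subspace k))
  (almost_sub_subl lowS aM).
move=> /almost_sub_trans; apply.
have lTi : is_linear (Tnd D A \o @dsingle R n X k).
  by move=> a x y; rewrite /= dsingle_linear lT.
have := almost_sub_add (Tnd D A @` low k.-1) (almost_sub_image lTi kerD).
move=> /(almost_sub_subl (U' := _)) aT; apply: almost_sub_subr (aT _ _).
  move=> y [_ [_ -> <-]] /=; rewrite (is_linear0 (dsingle_linear (i := k))).
  by rewrite (is_linear0 lT) subr0.
move=> _ [[x lx <-] lTx] /=; exists (Tnd D A (dsingle (x k))).
  exists (x k) => //=; rewrite -Tnd_low_coord//; apply: lTx.
  by rewrite prednK.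
exists (x - dsingle (x k)); last by rewrite (is_linearB lT).
move=> s ks; rewrite -[LHS]/(x s - dsingle (x k) s).
have [ks'|ks'] := eqVneq k s; first by case: s / ks' ks => _; rewrite dsingle_in subrr.
by rewrite dsingle_out// subr0 lx// ltn_neqAle ks' -(prednK k0).
Qed.

Lemma almost_sub_diag (k : 'I_n) : almost_sub setT (range (Tnd D A)) ->
  (forall s : 'I_n, (k < s)%N -> almost_sub [set x | D s x = 0] [set 0]) ->
  almost_sub setT (range (D k)).
Proof.
move=> aT kerD.
(* The induction on [j = n - 1 - t] lowers [t] from [n - 1] to [k]. Finally, the [k]-th coordinates
   of the image of [low k] form the range of [D k]. *)
have lowP j t : (t + j).+1 = n -> (k <= t)%N -> almost_sub (low t) (Tnd D A @` low t).
  elim: j t => [t tn kt|j IH t tn kt].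
    have -> : low t = setT; last exact: aT.
    apply/seteqP; split=> // x _ s; rewrite addn0 in tn.
    by rewrite ltnNge -ltnS tn ltn_ord.
  have tn' : (t.+1 < n)%N by rewrite -tn addnS !ltnS leq_addr.
  apply: (@almost_sub_low_step (Ordinal tn')) => //; first exact: kerD.
  by apply: IH; rewrite ?addSnnS// leqW.
have /lowP/(_ (leqnn _)) : (k + (n - k.+1)).+1 = n by rewrite -addSn subnKC.
have lk : is_linear (fun x : E => x k) by have [] := blin_proj X k.
move=> /(almost_sub_image lk) /(almost_sub_subl (U' := setT)) aDk.
apply: almost_sub_subr (aDk _).
  by move=> _ [_ [x lx <-] <-]; rewrite Tnd_low_coord//; exists (x k).
move=> y _; exists (dsingle y); last exact: dsingle_in.
by move=> s ks; rewrite dsingle_out// neq_ltn ks.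
Qed.
End Triangular.

(** * Spectra and the union formula *)

Section Spectrum.
Variable R : realType.
Local Notation K := R[i].

Lemma eadd_sum_inf (I : eqType) (s : seq I) (P : pred I) (f : I -> enat) i :
  i \in s -> P i -> f i = einf -> \big[eadd/Some 0%N]_(j <- s | P j) f j = einf.
Proof.
move=> + Pi fi; elim: s => [//|j s IH]; rewrite inE big_cons.
have [<- _|_ /= /IH ->] := eqVneq i j; first by rewrite Pi fi.
by case: ifP => // _; case: (f j).
Qed.

Lemma blin_lmT (V : completeNormedModType K) (T : V -> V) lambda :
  bounded_op T -> blin (@rnorm R V) (@rnorm R V) (lmT lambda T).
Proof.
move=> /bounded_op_blin bT; apply: (blinB (rnorm_banach V) (f := *:%R lambda) _ bT).
split=> [a x y|]; first by rewrite scalerDr !scalerA mulrC.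
exists (cmod lambda) => [|x]; first exact: cmod_ge0.
by rewrite (bnormZ (rnorm_banach V)).
Qed.

Lemma kerS_Tml (V : completeNormedModType K) (T : V -> V) lambda :
  kerS (Tml T lambda) = kerS (lmT lambda T).
Proof.
apply/seteqP; split=> x; rewrite /kerS /Tml /lmT /= => /eqP.
  by rewrite subr_eq0 => /eqP ->; rewrite subrr.
by rewrite subr_eq0 => /eqP ->; rewrite subrr.
Qed.

Lemma range_Tml (V : completeNormedModType K) (T : V -> V) lambda :
  is_linear T -> range (Tml T lambda) = range (lmT lambda T).
Proof.
move=> lT; apply/seteqP; split=> _ [x _ <-]; exists (- x) => //;
  by rewrite /Tml /lmT (is_linearN lT) scalerN opprK addrC.
Qed.

Lemma lmT_Tnd n (X : 'I_n -> completeNormedModType K) (D : forall k : 'I_n, X k -> X k)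
    (A : forall i j : 'I_n, X j -> X i) (lambda : K) :
  lmT lambda (Tnd D A) = Tnd (fun k => lmT lambda (D k)) (fun i j x => - A i j x).
Proof.
apply/funext => x; apply: functional_extensionality_dep => i.
rewrite -[LHS]/(lambda *: x i - (D i (x i) + _)) /Tnd /lmT opprD addrA sumrN.
by [].
Qed.

End Spectrum.

Theorem mainTheorem8 (R : realType) (n : nat)
  (X : 'I_n -> completeNormedModType R[i]) (D : forall k : 'I_n, X k -> X k) :
  (2 <= n)%N ->
  (forall k : 'I_n, bounded_op (D k)) ->
  (forall s : 'I_n, (1 <= s)%N -> (s <= n - 2)%N ->
     forall lambda : R[i], complements_condition (Tml (D s) lambda)) ->
  forall A : forall i j : 'I_n, X j -> X i,
  (forall i j : 'I_n, (i < j)%N -> bounded_op (A i j)) ->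
  \bigcup_(k in [set: 'I_n]) sigma_re (D k) =
    sigma_re (Tnd D A) `|` Delta1 D `|` Delta2 D.
Proof.
move=> n2 bD _ A bA.
have n0 : (n.-1 < n)%N by case: n n2 {X D bD A bA}.
have blD lam k := blin_lmT lam (bD k).
have blA (i j : 'I_n) : (i < j)%N ->
    blin (@rnorm R (X j)) (@rnorm R (X i)) (fun x => - A i j x).
  by move=> /bA /bounded_op_blin bAij; exact: (blinN (rnorm_banach _)).
(* By [lmT_Tnd], this is [lam] minus the operator matrix: again upper triangular, with the
   off-diagonal entries negated. *)
pose T lam := Tnd (fun k => lmT lam (D k)) (fun i j x => - A i j x).
have sigT lam : sigma_re (Tnd D A) lam <->
    ~ right_invertible_mod (@dnorm R n X) (@dnorm R n X) (T lam).
  rewrite /sigma_re /= lmT_Tnd -/(T lam).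
  have := right_fredholmP (dnorm_banach X) (@bounded_op_dsum R n X) (T := T lam).
  by move=> ->//; apply/bounded_op_dsum; exact: blin_Tnd.
have sigD lam k : sigma_re (D k) lam <->
    ~ right_invertible_mod (@rnorm R (X k)) (@rnorm R (X k)) (lmT lam (D k)).
  have := right_fredholmP (rnorm_banach (X k)) (@bounded_op_blin R (X k) (X k)) (T := lmT lam (D k)).
  by rewrite /sigma_re /= => ->//; apply/bounded_op_blin.
have betaE lam k : beta (Tml (D k) lam) = beta (lmT lam (D k)).
  by rewrite /beta range_Tml//; case: (bD k).
have alphaE lam k : alpha (Tml (D k) lam) = alpha (lmT lam (D k)).
  by rewrite /alpha kerS_Tml.
apply/seteqP; split=> lam.
  move=> [k0 _ k0P].
  have [RT|/sigT] := pselect (right_invertible_mod (@dnorm R n X) (@dnorm R n X) (T lam));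
    last by left; left.
  have [|nD2] := pselect (Delta2 D lam); first by right.
  left; right.
  pose m := Ordinal n0.
  have rm : ~ sigma_re (D m) lam.
    by move=> /sigD; apply; exact: (last_right_invertible_mod (m := m) _ RT).
  (* Were every [beta] finite, the failure of [D k0] to be right Fredholm would come from its
     kernel, placing [lam] in [Delta2]. *)
  have [s0 s0P] : exists s, beta (Tml (D s) lam) = einf.
    apply: contrapT => /forallNP nb; apply: nD2; exists k0 => //; split=> // ck0.
    by apply: k0P; split; [rewrite -betaE; exact: nb|rewrite -kerS_Tml].
  have [k /asboolP kP kmax] :=
    @arg_maxnP _ s0 (fun s => `[< beta (Tml (D s) lam) = einf >]) val (asboolT s0P).
  have kfin (s : 'I_n) : (k < s)%N -> beta (Tml (D s) lam) <> einf.
    by move=> ks /asboolP /kmax /=; rewrite leqNgt ks.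
  (* The last diagonal entry is right Fredholm, so its [beta] is finite and [k] is not the last
     index. *)
  have km : (k < n.-1)%N.
    have : (k <= n.-1)%N by rewrite -ltnS prednK// (leq_ltn_trans _ n2).
    rewrite leq_eqVlt => /orP[/eqP km|//]; exfalso; apply: rm => -[+ _].
    by rewrite -betaE -(_ : k = m)//; exact: val_inj.
  exists k => //; split; last first.
    by move=> s sn; rewrite (_ : s = m)//; exact: val_inj.
  split=> //; split=> [s ks _|]; first exact: kfin.
  (* A finite sum makes every later kernel finite-dimensional, and [almost_sub_diag] would then make
     [beta] finite at [k]. *)
  apply: contrapT => sfin; have : ~ (beta (Tml (D k) lam) <> einf) by [].
  apply; rewrite betaE betaP; apply: (almost_sub_diag (blD lam) blA).
    have [S [F [_ fF TS]]] := RT.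
    by apply: (finrank_range_almost_sub fF) => y; exists (S y) => //; exact: TS.
  move=> s ks; apply: alpha_almost_sub; rewrite -alphaE => sinf; apply: sfin.
  exact: (eadd_sum_inf (i := s) (mem_index_enum s)).
(* Reverse inclusion: back-substitution handles the spectrum of the matrix; [Delta1] supplies an
   infinite [beta] and [Delta2] a non-complemented kernel. *)
move=> [[/sigT nT|[k _ [[bk _] _]]]|[k _ [_ ck]]].
- apply: contrapT => nD; apply: nT.
  apply: (Tnd_right_invertible_mod blA) => k; apply: contrapT => /sigD Dk.
  by apply: nD; exists k.
- by exists k => //; move=> [+ _]; rewrite -betaE.
- by exists k => //; move=> [_]; rewrite -kerS_Tml.
Qed.
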